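(* Let $R$ be a maximal subring of a ring $T$. Then one of the following conditions holds: (i) There exists a strongly prime ideal $Q$ of $T$ such that $Q\subseteq R$. In particular, $Nil^*(T)\subseteq Q\subseteq (R:T)$. (ii) $Nil^*(T)\cap R=Nil^*(R)$. In particular, either $Nil^*(T)=Nil^*(R)$ or $R/Nil^*(R)\cong T/Nil^*(T)$ as rings. Moreover, if there exists a nonzero ideal $I$ of $T$ such that $R\cap I=0$, then either $Nil^*(T)\cap R=Nil^*(R)$, or the following hold: (1) $I^2=I$. (2) $(R:T)=(R:T)_l=(R:T)_r=ann_T(I)$ is a strongly prime ideal of $T$ which is a minimal prime ideal of $T$. (3) $Nil^*(R)\nsubseteq (R:T)$. In particular, $IN=NI$ and $TN=NT$, where $N=Nil^*(R)$. (4) $(R:T)\oplus I$ is a prime ideal of $T$ which is not a strongly prime ideal of $T$. In particular, $(R:T)\oplus I$ is not a maximal ideal of $T$ and $dim(T)\geq 2$. (5) $I$ is unique, i.e., if $I_1$ is a nonzero ideal of $T$ such that $R\cap I_1=0$, then $I_1=I$.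
   Context: All rings are associative and unital (not necessarily commutative), and subrings contain the identity of the big ring; ''ideal'' means two-sided ideal. A maximal subring $R$ of $T$ is a proper subring with no subring strictly between $R$ and $T$. $Nil^*$ denotes the upper nilradical (the largest nil ideal). An ideal $P$ of $T$ is strongly prime if $T/P$ is a prime ring with no nonzero nil ideals; $Nil^*(T)$ is the intersection of all strongly prime ideals of $T$. Conductors: $(R:T)=\{x\in T: TxT\subseteq R\}$, $(R:T)_l=\{x\in T: Tx\subseteq R\}$, $(R:T)_r=\{x\in T: xT\subseteq R\}$. $ann_T(I)=\{t\in T: tI=It=0\}$. $dim$ denotes the classical Krull dimension, i.e. the supremum of lengths of chains of prime ideals. *)

(* Defs.v *)
From HB Require Import structures.
From mathcomp Require Import all_boot all_order all_algebra.
From mathcomp Require Import mathcomp_extra boolp classical_sets.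
From mathcomp Require Import constructive_ereal.

Set Implicit Arguments.
Unset Strict Implicit.
Unset Printing Implicit Defensive.

Import Order.TTheory GRing.Theory Num.Theory.

Local Open Scope classical_set_scope.
Local Open Scope ring_scope.
Local Open Scope quotient_scope.

Record subring (T : pzRingType) := Subring {
  subring_set :> set T;
  subringP : subring_closed [in subring_set] }.

Definition subring_pred (T : pzRingType) (R : subring T) : {pred T} :=
  [in subring_set R].

HB.instance Definition _ (T : pzRingType) (R : subring T) :=
  GRing.isSubringClosed.Build T (subring_pred R) (subringP R).

Definition subring_type (T : pzRingType) (R : subring T) : Type :=
  {x : T | x \in subring_pred R}.

HB.instance Definition _ (T : pzRingType) (R : subring T) :=
  SubChoice.on (subring_type R).
HB.instance Definition _ (T : pzRingType) (R : subring T) :=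
  GRing.SubChoice_isSubPzRing.Build T _ (subring_type R) (subringP R).

Definition maximal_subring (T : pzRingType) (R : subring T) : Prop :=
  R <> setT :> set T /\
  forall S : subring T, R `<=` S -> S = R :> set T \/ S = setT :> set T.

Definition is_ideal (T : pzRingType) (I : set T) : Prop :=
  zmod_closed [in I] /\ forall a x : T, I x -> I (a * x) /\ I (x * a).

Record ideal (T : pzRingType) := Ideal {
  ideal_set :> set T;
  idealP : is_ideal ideal_set }.

Definition ideal_pred (T : pzRingType) (I : ideal T) : {pred T} :=
  [in ideal_set I].

HB.instance Definition _ (T : pzRingType) (I : ideal T) :=
  GRing.isZmodClosed.Build T (ideal_pred I) (idealP I).1.

(* [ring_quotient] supplies the additive quotient, but the multiplication only
   for commutative rings; [pzRingType] is needed as [I] may be the whole ring. *)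

Definition quotient (T : pzRingType) (I : ideal T) : Type :=
  Quotient.quot (ideal_pred I).

HB.instance Definition _ (T : pzRingType) (I : ideal T) :=
  GRing.Zmodule.on (quotient I).
HB.instance Definition _ (T : pzRingType) (I : ideal T) :=
  EqQuotient.on (quotient I).

Section QuotientRing.
Variables (T : pzRingType) (I : ideal T).
Local Notation Q := (Quotient.quot (ideal_pred I)).

Definition quotient_one : Q := lift_cst Q 1.
Definition quotient_mul := lift_op2 Q *%R.

Lemma quotient_pi_mul :
  {morph \pi_Q : x y / x * y >-> quotient_mul x y}.
Proof.
move=> x y; unlock quotient_mul; apply/eqP; rewrite -Quotient.idealrBE.
set x' := repr _; set y' := repr _.
have hx : x - x' \in ideal_pred I by rewrite Quotient.idealrBE reprK.
have hy : y - y' \in ideal_pred I by rewrite Quotient.idealrBE reprK.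
have -> : x * y - x' * y' = (x - x') * y + x' * (y - y').
  by rewrite mulrBl mulrBr addrA addrNK.
have idealI := (idealP I).2.
apply: rpredD; apply: mem_set.
  exact: (idealI y _ (set_mem hx)).2.
exact: (idealI x' _ (set_mem hy)).1.
Qed.
Canonical quotient_pi_one_morph := PiConst quotient_one.
Canonical quotient_pi_mul_morph := PiMorph2 quotient_pi_mul.

Lemma quotient_mulA : associative quotient_mul.
Proof. by move=> x y z; rewrite -[x]reprK -[y]reprK -[z]reprK !piE mulrA. Qed.

Lemma quotient_mul1 : left_id quotient_one quotient_mul.
Proof. by move=> x; rewrite -[x]reprK !piE mul1r. Qed.

Lemma quotient_mulr1 : right_id quotient_one quotient_mul.
Proof. by move=> x; rewrite -[x]reprK !piE mulr1. Qed.

Lemma quotient_mulDl : left_distributive quotient_mul (+%R : Q -> Q -> Q).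
Proof.
by move=> x y z; rewrite -[x]reprK -[y]reprK -[z]reprK !piE mulrDl.
Qed.

Lemma quotient_mulDr : right_distributive quotient_mul (+%R : Q -> Q -> Q).
Proof.
by move=> x y z; rewrite -[x]reprK -[y]reprK -[z]reprK !piE mulrDr.
Qed.

HB.instance Definition _ := GRing.Zmodule_isPzRing.Build (quotient I)
  quotient_mulA quotient_mul1 quotient_mulr1 quotient_mulDl quotient_mulDr.

Definition quotient_proj (x : T) : quotient I := \pi_Q x.

Lemma quotient_proj_is_zmod_morphism : zmod_morphism quotient_proj.
Proof. by move=> x y; rewrite /quotient_proj; exact: (raddfB \pi_Q). Qed.

Lemma quotient_proj_is_monoid_morphism : monoid_morphism quotient_proj.
Proof.
split=> [|x y]; rewrite /quotient_proj; last exact: quotient_pi_mul.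
by rewrite -[RHS]/quotient_one piE.
Qed.

HB.instance Definition _ := GRing.isZmodMorphism.Build T (quotient I)
  quotient_proj quotient_proj_is_zmod_morphism.
HB.instance Definition _ := GRing.isMonoidMorphism.Build T (quotient I)
  quotient_proj quotient_proj_is_monoid_morphism.

Lemma quotient_proj_eq0 (x : T) : quotient_proj x = 0 <-> ideal_set I x.
Proof.
rewrite -(rmorph0 quotient_proj) /quotient_proj.
split=> [/eqP|Ix]; first by rewrite -Quotient.idealrBE subr0 => /set_mem.
by apply/eqP; rewrite -Quotient.idealrBE subr0; apply: mem_set.
Qed.

Lemma quotient_proj_surj (y : quotient I) : exists x, quotient_proj x = y.
Proof. by exists (repr (y : Q)); rewrite /quotient_proj reprK. Qed.

End QuotientRing.

Definition ring_isomorphic (A B : pzRingType) : Prop :=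
  exists f : {rmorphism A -> B}, bijective f.

Definition set_add (T : pzRingType) (A B : set T) : set T :=
  [set a + b | a in A & b in B].

(* The additive subgroup generated by the products, when [A] or [B] is an
   additive subgroup. *)
Definition set_mul (T : pzRingType) (A B : set T) : set T :=
  [set x | exists (n : nat) (a b : 'I_n -> T),
     (forall i, A (a i) /\ B (b i)) /\ x = \sum_(i < n) a i * b i].

Definition is_prime_ideal (T : pzRingType) (P : set T) : Prop :=
  [/\ is_ideal P, P <> setT &
      forall A B : set T, is_ideal A -> is_ideal B ->
        set_mul A B `<=` P -> A `<=` P \/ B `<=` P].

Definition is_minimal_prime (T : pzRingType) (P : set T) : Prop :=
  is_prime_ideal P /\
  forall P' : set T, is_prime_ideal P' -> P' `<=` P -> P' = P.

Definition is_maximal_ideal (T : pzRingType) (M : set T) : Prop :=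
  [/\ is_ideal M, M <> setT &
      forall J : set T, is_ideal J -> M `<=` J -> J = M \/ J = setT].

Definition is_prime_ring (T : pzRingType) : Prop :=
  is_prime_ideal [set 0 : T].

Definition is_nil (T : pzRingType) (A : set T) : Prop :=
  forall x, A x -> exists n : nat, x ^+ n = 0.

Definition is_strongly_prime (T : pzRingType) (P : set T) : Prop :=
  exists idP : is_ideal P,
    is_prime_ring (quotient (Ideal idP)) /\
    forall J : set (quotient (Ideal idP)),
      is_ideal J -> is_nil J -> J = [set 0].

(* The sum of two nil ideals is nil, so the union of all nil ideals is itself
   a nil ideal, hence the largest one. *)

Definition nil_union (T : pzRingType) : set T :=
  \bigcup_(I in [set I : set T | is_ideal I /\ is_nil I]) I.

Lemma nil_union_nil (T : pzRingType) : is_nil (@nil_union T).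
Proof. by move=> x [I [_ nilI] /nilI]. Qed.

Lemma nil_union_is_ideal (T : pzRingType) : is_ideal (@nil_union T).
Proof.
split; last first.
  move=> a x [I [idI nilI] Ix].
  by have [Iax Ixa] := idI.2 a x Ix; split; exists I.
have id0 : is_ideal [set 0 : T].
  split; last by move=> a x /= ->; rewrite mulr0 mul0r.
  split; first exact: mem_set.
  by move=> x y /set_mem /= -> /set_mem /= ->; rewrite subr0; apply: mem_set.
split.
  apply: mem_set; exists [set 0] => //; split=> // x /= ->.
  by exists 1%N; rewrite expr1.
move=> x y /set_mem[I [idI nilI] Ix] /set_mem[J [idJ nilJ] Jy].
apply: mem_set.
pose K : set T := [set u | exists2 v, J v & I (u - v)].
exists K; last first.
  exists (- y).
    rewrite -sub0r; apply: set_mem.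
    by apply: idJ.1.2; [exact: idJ.1.1|exact: mem_set].
  by rewrite /= opprK subrK.
split.
  split; [split|].
  - apply: mem_set; exists 0; first exact: set_mem idJ.1.1.
    by rewrite subrr; exact: set_mem idI.1.1.
  - move=> u u' /set_mem[v Jv Iu] /set_mem[v' Jv' Iu'].
    apply: mem_set; exists (v - v').
      by apply: set_mem; apply: idJ.1.2; exact: mem_set.
    have -> : u - u' - (v - v') = u - v - (u' - v').
      by rewrite !opprD !opprK addrACA.
    by apply: set_mem; apply: idI.1.2; exact: mem_set.
  - move=> a u [v Jv Iu]; have [J1 J2] := idJ.2 a v Jv.
    have [I1 I2] := idI.2 a _ Iu.
    by split; [exists (a * v) => //; rewrite -mulrBr|
               exists (v * a) => //; rewrite -mulrBl].
move=> u [v Jv Iu]; have [n vn0] := nilJ v Jv.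
have Iun : I (u ^+ n - v ^+ n).
  elim: (n) => [|k IHk]; first by rewrite !expr0 subrr; exact: set_mem idI.1.1.
  have -> : u ^+ k.+1 - v ^+ k.+1 =
            (u - v) * u ^+ k - v * - (u ^+ k - v ^+ k).
    by rewrite !exprS mulrN opprK mulrBl mulrBr addrA subrK.
  apply: set_mem; apply: idI.1.2; apply: mem_set.
    exact: (idI.2 (u ^+ k) _ Iu).2.
  apply: (idI.2 v _ _).1; rewrite -sub0r; apply: set_mem.
  by apply: idI.1.2; [exact: idI.1.1|exact: mem_set].
rewrite vn0 subr0 in Iun; have [m um0] := nilI _ Iun.
by exists (n * m)%N; rewrite exprM.
Qed.

Definition upper_nilradical (T : pzRingType) : ideal T :=
  Ideal (@nil_union_is_ideal T).

Lemma upper_nilradical_largest (T : pzRingType) (I : set T) :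
  is_ideal I -> is_nil I -> I `<=` upper_nilradical T.
Proof. by move=> idI nilI x Ix; exists I. Qed.

Definition subring_nilradical (T : pzRingType) (R : subring T) : set T :=
  [set \val x | x in (upper_nilradical (subring_type R) : set _)].

Definition conductor (T : pzRingType) (R : set T) : set T :=
  [set x | forall s t : T, R (s * x * t)].

Definition conductorl (T : pzRingType) (R : set T) : set T :=
  [set x | forall s : T, R (s * x)].

Definition conductorr (T : pzRingType) (R : set T) : set T :=
  [set x | forall s : T, R (x * s)].

Definition ann (T : pzRingType) (I : set T) : set T :=
  [set t | forall x, I x -> t * x = 0 /\ x * t = 0].

Definition prime_chain (T : pzRingType) (n : nat)
    (P : 'I_n.+1 -> set T) : Prop :=
  (forall i, is_prime_ideal (P i)) /\
  (forall i j : 'I_n.+1, (i < j)%N -> P i `<` P j).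

Definition prime_chain_lengths (T : pzRingType) : set (\bar int) :=
  [set (n%:Z)%:E | n in [set n | exists P : 'I_n.+1 -> set T, prime_chain P]].

(* [-oo] when there is no prime ideal; [krull_dim_is_sup] shows that the
   supremum always exists in [\bar int]. *)
Definition krull_dim (T : pzRingType) : \bar int :=
  supremum -oo%E (prime_chain_lengths T).

Lemma krull_dim_is_sup (T : pzRingType) :
  supremums (prime_chain_lengths T) (krull_dim T).
Proof.
rewrite /krull_dim /supremum; set L := prime_chain_lengths T.
case: ifPn => [/eqP -> |L0].
  by split=> [x []|x _]; exact: leNye.
case: xgetP => [x -> //|noSup]; exfalso.
pose A := [set n | exists P : 'I_n.+1 -> set T, prime_chain P].
have [ubA|nubA] := pselect (ubound A !=set0).
  have [m [mub mlub]] := nat_supremums_neq0 ubA.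
  apply: (noSup (m%:Z)%:E); split=> [_ [n An <-]|y yub].
    by rewrite lee_fin lez_nat; exact: mub An.
  have Am : A m.
    apply: contrapT => nAm; case: m mub mlub nAm => [|m] mub mlub nAm.
      have /set0P[_ [k Ak _]] := L0; have := mub k Ak.
      by rewrite leEnat leqn0 => /eqP k0; apply: nAm; rewrite -k0.
    have : (m.+1 <= m)%O.
      apply: mlub => k Ak; have := mub k Ak; rewrite !leEnat leq_eqVlt.
      by case/orP=> [/eqP km|//]; case: nAm; rewrite -km.
    by rewrite leEnat ltnn.
  by apply: yub; exists m.
apply: (noSup +oo%E); split=> [x _|y yub]; first exact: leey.
case: y yub => [r| |] yub //.
- case: nubA; exists `|r|%N => n An.
  have : (n%:Z <= r)%R by rewrite -lee_fin; apply: yub; exists n.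
  by rewrite leEnat -lez_nat => /le_trans; apply; rewrite abszE ler_norm.
- have /set0P[x Lx] := L0; have := yub x Lx.
  by have [n _ <-] := Lx; rewrite leeNy_eq.
Qed.

(* Main.v *)
Require Import Defs.
From HB Require Import structures.
From mathcomp Require Import all_boot all_order all_algebra.
From mathcomp Require Import mathcomp_extra boolp classical_sets.
From mathcomp Require Import constructive_ereal.

Set Implicit Arguments.
Unset Strict Implicit.
Unset Printing Implicit Defensive.

Import Order.TTheory GRing.Theory Num.Theory.

Local Open Scope classical_set_scope.
Local Open Scope ring_scope.

(* For an ideal Q of T not contained in the maximal subring R one has R + Q = T,
   so T/Q is a quotient of R and, when Q is strongly prime, Nil*(R) lies in Q.
   Since Nil*(T) is the intersection of the strongly prime ideals, either some
   strongly prime Q lies in R or Nil*(R) lies in Nil*(T).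

   If R meets a nonzero ideal I trivially, maximality gives T = R + I, and any
   nonzero R-subbimodule C of I closed under products is all of I, because
   R + C = T.  Applied to I^2, IA, AI (A an ideal of R) and to the intersection
   of two such ideals I, this yields all the identities; primeness of Q turns
   IQ = 0 into Q = ann(I). *)

(** * Subbimodules and ideals *)

(** [R] is an arbitrary set of multipliers: [setT] gives ideals, a subring gives its subbimodules,
    and [set0] gives plain additive subgroups. *)
Definition is_subbimodule (T : pzRingType) (R A : set T) : Prop :=
  [/\ A 0, forall x y, A x -> A y -> A (x - y) &
      forall r x, R r -> A x -> A (r * x) /\ A (x * r)].

Lemma ideal_subbimodule (T : pzRingType) (I : set T) :
  is_ideal I <-> is_subbimodule setT I.
Proof.
split=> [[[I0 IB] IM]|[I0 IB IM]].
  split=> [|x y Ix Iy|r x _ Ix]; [exact: set_mem| |exact: IM].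
  by apply: set_mem; apply: IB; exact: mem_set.
split; last by move=> a x; exact: IM.
split; first exact: mem_set.
by move=> x y /set_mem Ix /set_mem Iy; apply: mem_set; exact: IB.
Qed.

Lemma subbimoduleN (T : pzRingType) (R A : set T) (x : T) :
  is_subbimodule R A -> A x -> A (- x).
Proof. by case=> A0 AB _ Ax; rewrite -sub0r; exact: AB. Qed.

Lemma subbimoduleD (T : pzRingType) (R A : set T) (x y : T) :
  is_subbimodule R A -> A x -> A y -> A (x + y).
Proof.
move=> mA Ax Ay; rewrite -[y]opprK; have [_ AB _] := mA.
by apply: AB => //; exact: subbimoduleN mA Ay.
Qed.

Lemma subbimoduleS (T : pzRingType) (R S A : set T) :
  R `<=` S -> is_subbimodule S A -> is_subbimodule R A.
Proof. by move=> RS [A0 AB AM]; split=> // r x /RS; exact: AM. Qed.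

Lemma subbimoduleI (T : pzRingType) (R A B : set T) :
  is_subbimodule R A -> is_subbimodule R B -> is_subbimodule R (A `&` B).
Proof.
move=> [A0 AB AM] [B0 BB BM]; split=> // [x y [Ax Bx] [Ay By]|r x Rr [Ax Bx]].
  by split; [exact: AB|exact: BB].
have [Arx Axr] := AM r x Rr Ax; have [Brx Bxr] := BM r x Rr Bx.
by split.
Qed.

Lemma ideal_subr (T : pzRingType) (R I : set T) :
  is_ideal I -> is_subbimodule R I.
Proof. by move=> /ideal_subbimodule; exact: subbimoduleS. Qed.

Lemma ideal0 (T : pzRingType) (I : set T) : is_ideal I -> I 0.
Proof. by move=> /ideal_subbimodule[]. Qed.

Lemma idealB (T : pzRingType) (I : set T) (x y : T) :
  is_ideal I -> I x -> I y -> I (x - y).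
Proof. by move=> /ideal_subbimodule[_ + _]; exact. Qed.

Lemma idealD (T : pzRingType) (I : set T) (x y : T) :
  is_ideal I -> I x -> I y -> I (x + y).
Proof. by move=> /ideal_subbimodule; exact: subbimoduleD. Qed.

Lemma idealMl (T : pzRingType) (I : set T) (a x : T) :
  is_ideal I -> I x -> I (a * x).
Proof. by case=> _ IM /(IM a)[]. Qed.

Lemma idealMr (T : pzRingType) (I : set T) (a x : T) :
  is_ideal I -> I x -> I (x * a).
Proof. by case=> _ IM /(IM a)[]. Qed.

Lemma zero_ideal (T : pzRingType) : is_ideal [set 0 : T].
Proof.
apply/ideal_subbimodule; split=> //; first by move=> x y /= -> ->; rewrite subr0.
by move=> r x _ /= ->; rewrite mulr0 mul0r.
Qed.

Lemma ideal_top (T : pzRingType) (I : set T) : is_ideal I -> I 1 -> I = setT.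
Proof.
by move=> idI I1; apply/seteqP; split=> // x _; rewrite -[x]mulr1; exact: idealMl.
Qed.

Lemma ideal_expB (T : pzRingType) (I : set T) (x y : T) (n : nat) :
  is_ideal I -> I (x - y) -> I (x ^+ n - y ^+ n).
Proof.
move=> idI Ixy; elim: n => [|n IHn].
  by rewrite !expr0 subrr; exact: ideal0.
have -> : x ^+ n.+1 - y ^+ n.+1 = (x - y) * x ^+ n + y * (x ^+ n - y ^+ n).
  by rewrite !exprS mulrBl mulrBr addrA subrK.
by apply: idealD => //; [exact: idealMr|exact: idealMl].
Qed.

(** * Products and sums of additive subgroups *)

Lemma set_mul_mem (T : pzRingType) (A B : set T) (a b : T) :
  A a -> B b -> set_mul A B (a * b).
Proof.
move=> Aa Bb; exists 1%N, (fun=> a), (fun=> b); split=> //.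
by rewrite big_ord1.
Qed.

Lemma set_mul_sub (T : pzRingType) (R A B C : set T) :
  is_subbimodule R C -> (forall a b, A a -> B b -> C (a * b)) ->
  set_mul A B `<=` C.
Proof.
move=> mC ABC _ [n [a [b [ABi ->]]]]; apply: (big_ind C).
- by case: mC.
- by move=> x y; exact: subbimoduleD mC.
- by move=> i _; have [Aa Bb] := ABi i; exact: ABC.
Qed.

Lemma set_mulMl (T : pzRingType) (A B : set T) (x y : T) :
  (forall a, A a -> A (x * a)) -> set_mul A B y -> set_mul A B (x * y).
Proof.
move=> Ax [n [a [b [ABi ->]]]]; exists n, (fun i => x * a i), b; split=> [i|].
  by have [Aa Bb] := ABi i; split=> //; exact: Ax.
by rewrite mulr_sumr; apply: eq_bigr => i _; rewrite mulrA.
Qed.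

Lemma set_mulMr (T : pzRingType) (A B : set T) (x y : T) :
  (forall b, B b -> B (b * x)) -> set_mul A B y -> set_mul A B (y * x).
Proof.
move=> Bx [n [a [b [ABi ->]]]]; exists n, a, (fun i => b i * x); split=> [i|].
  by have [Aa Bb] := ABi i; split=> //; exact: Bx.
by rewrite mulr_suml; apply: eq_bigr => i _; rewrite mulrA.
Qed.

Lemma set_mul_subbimodule (T : pzRingType) (R A B : set T) :
  is_subbimodule R A -> is_subbimodule R B -> is_subbimodule R (set_mul A B).
Proof.
move=> mA mB; have [A0 _ AM] := mA; have [_ _ BM] := mB; split.
- exists 0%N, (fun=> 0), (fun=> 0); split; first by case.
  by rewrite big_ord0.
- move=> _ _ [n [a [b [ABi ->]]]] [m [a' [b' [ABi' ->]]]].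
  (* A difference of two sums of products is one sum over the concatenated index range, with the
     sign moved into the left factors. *)
  exists (n + m)%N,
    (fun i => match split i with inl j => a j | inr j => - a' j end),
    (fun i => match split i with inl j => b j | inr j => b' j end).
  split.
    move=> i; case: (split i) => j; first exact: ABi.
    by have [Aa Bb] := ABi' j; split=> //; exact: subbimoduleN mA Aa.
  rewrite big_split_ord /= -sumrN; congr (_ + _); apply: eq_bigr => i _.
    by rewrite (unsplitK (inl i)).
  by rewrite (unsplitK (inr i)) mulNr.
- move=> r x Rr ABx; split; [apply: set_mulMl|apply: set_mulMr] => // y.
    by move=> /(AM r y Rr)[].
  by move=> /(BM r y Rr)[].
Qed.

Lemma set_add_ideal (T : pzRingType) (A B : set T) :
  is_ideal A -> is_ideal B -> is_ideal (set_add A B).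
Proof.
move=> idA idB; apply/ideal_subbimodule; split.
- by exists 0; [exact: ideal0|exists 0; [exact: ideal0|rewrite addr0]].
- move=> _ _ [a Aa [b Bb <-]] [a' Aa' [b' Bb' <-]].
  exists (a - a'); first exact: idealB.
  by exists (b - b'); [exact: idealB|rewrite opprD addrACA].
- move=> r _ _ [a Aa [b Bb <-]]; split.
    exists (r * a); first exact: idealMl.
    by exists (r * b); [exact: idealMl|rewrite mulrDr].
  exists (a * r); first exact: idealMr.
  by exists (b * r); [exact: idealMr|rewrite mulrDl].
Qed.

Lemma set_addl (T : pzRingType) (A B : set T) : B 0 -> A `<=` set_add A B.
Proof. by move=> B0 a Aa; exists a => //; exists 0; rewrite ?addr0. Qed.

Lemma set_addr (T : pzRingType) (A B : set T) : A 0 -> B `<=` set_add A B.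
Proof. by move=> A0 b Bb; exists 0 => //; exists b; rewrite ?add0r. Qed.

(** * Prime and strongly prime ideals, in the quotient and in the ring *)

Lemma prime_ideal_mul (T : pzRingType) (P A B : set T) :
  is_prime_ideal P -> is_ideal A -> is_ideal B ->
  (forall a b, A a -> B b -> P (a * b)) -> A `<=` P \/ B `<=` P.
Proof.
move=> [idP _ primeP] idA idB ABP; apply: primeP => //.
exact: set_mul_sub (proj1 (ideal_subbimodule _) idP) ABP.
Qed.

Lemma image_ideal (S T : pzRingType) (f : {rmorphism S -> T}) (A : set S) :
  (forall y, exists x, f x = y) -> is_ideal A -> is_ideal (f @` A).
Proof.
move=> surj idA; apply/ideal_subbimodule; split.
- by exists 0; [exact: ideal0|rewrite rmorph0].
- move=> _ _ [x Ax <-] [y Ay <-]; exists (x - y); last by rewrite rmorphB.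
  exact: idealB.
- move=> r _ _ [x Ax <-]; have [s <-] := surj r.
  by split; [exists (s * x)|exists (x * s)];
    rewrite ?rmorphM //; [exact: idealMl|exact: idealMr].
Qed.

Lemma preimage_ideal (S T : pzRingType) (f : {rmorphism S -> T}) (B : set T) :
  is_ideal B -> is_ideal (f @^-1` B).
Proof.
move=> idB; apply/ideal_subbimodule; split=> /=.
- by rewrite rmorph0; exact: ideal0.
- by move=> x y Bx By; rewrite rmorphB; exact: idealB.
- by move=> r x _ Bx; rewrite !rmorphM; split; [exact: idealMl|exact: idealMr].
Qed.

(** Images and preimages under the projection carry ideals both ways, and its kernel is [P], so
    products landing in [P] are products vanishing in the quotient. *)
Lemma quotient_prime (T : pzRingType) (P : set T) (idP : is_ideal P) :
  is_prime_ring (quotient (Ideal idP)) <-> is_prime_ideal P.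
Proof.
pose f : {rmorphism T -> _} := @quotient_proj _ (Ideal idP).
have f0 x : f x = 0 <-> P x := quotient_proj_eq0 (Ideal idP) x.
have fS : forall y, exists x, f x = y := @quotient_proj_surj _ (Ideal idP).
split=> [primeQ|primeP].
  have [_ n0T _] := primeQ; split=> //.
    move=> PT; apply: n0T; apply/seteqP; split=> // y _.
    by have [x <-] := fS y; apply/f0; rewrite PT.
  move=> A B idA idB ABP.
  have [|fA|fB] := prime_ideal_mul primeQ (image_ideal fS idA)
                     (image_ideal fS idB).
  - move=> _ _ [a Aa <-] [b Bb <-]; rewrite -rmorphM; apply/f0.
    exact/ABP/set_mul_mem.
  - by left=> a Aa; apply/f0/fA; exists a.
  - by right=> b Bb; apply/f0/fB; exists b.
have [_ PT _] := primeP; split.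
- exact: zero_ideal.
- move=> QT; apply: PT; apply/seteqP; split=> // x _; apply/f0.
  by have : [set: quotient (Ideal idP)] (f x) by []; rewrite -QT.
- move=> A B idA idB AB0.
  have [|fA|fB] := prime_ideal_mul primeP (preimage_ideal f idA)
                     (preimage_ideal f idB).
  + by move=> a b Aa Bb; apply/f0; rewrite rmorphM; exact/AB0/set_mul_mem.
  + by left=> y; have [x <-] := fS y => Ax; exact/f0/fA.
  + by right=> y; have [x <-] := fS y => Bx; exact/f0/fB.
Qed.

(** Nilness of the image of [J] in the quotient by [P], phrased inside [T]. *)
Definition is_nil_mod (T : pzRingType) (P J : set T) : Prop :=
  forall x, J x -> exists n, P (x ^+ n).

(** The image of an ideal nil modulo [P] is nil in the quotient, and the preimage of a nil ideal is
    nil modulo [P]. Later arguments use this form, without the quotient. *)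
Lemma strongly_primeP (T : pzRingType) (P : set T) :
  is_strongly_prime P <->
  is_prime_ideal P /\
  forall J : set T, is_ideal J -> is_nil_mod P J -> J `<=` P.
Proof.
split=> [[idP [/quotient_prime primeP nil0]]|[primeP nilP]].
  split=> // J idJ nilJ x Jx.
  pose f : {rmorphism T -> _} := @quotient_proj _ (Ideal idP).
  have fJ : f @` J = [set 0].
    apply: nil0; first exact: (image_ideal (@quotient_proj_surj _ (Ideal idP))).
    move=> _ [y Jy <-]; have [n Pyn] := nilJ y Jy; exists n.
    by rewrite -rmorphXn; exact/quotient_proj_eq0.
  apply/(quotient_proj_eq0 (Ideal idP)).
  by have : (f @` J) (f x) by [exists x]; rewrite fJ.
have [idP PT _] := primeP; exists idP; split; first exact/quotient_prime.
pose f : {rmorphism T -> _} := @quotient_proj _ (Ideal idP).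
move=> J idJ nilJ; apply/seteqP; split=> [y|_ ->]; last exact: ideal0.
have [x <-] := quotient_proj_surj y => Jx.
apply/quotient_proj_eq0; apply: (nilP (f @^-1` J)) => //.
  exact: preimage_ideal.
move=> z Jz; have [n fz0] := nilJ _ Jz; exists n.
by apply/(quotient_proj_eq0 (Ideal idP)); rewrite -fz0 rmorphXn.
Qed.

(** * The upper nilradical as the intersection of the strongly prime ideals *)

(** [P] is maximal among the ideals containing [P0] and missing every power of [y], so each ideal
    not inside [P] has an element congruent to a power of [y] modulo [P]. For [A] and [B] with
    product in [P], this would put some [y ^+ (n + m)] in [P]; for [J] nil modulo [P], some
    [y ^+ (n * m)]. The exponent 0 is included, which keeps [P] proper. *)
Lemma strongly_prime_avoiding (T : pzRingType) (P0 : set T) (y : T) :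
  is_ideal P0 -> (forall n, ~ P0 (y ^+ n)) ->
  exists P : set T, [/\ is_strongly_prime P, P0 `<=` P & ~ P y].
Proof.
move=> idP0 P0y.
(* Writing the ideals as P0 `|` X makes the empty chain admissible for Zorn. *)
pose avoids := [set X : set T |
  is_ideal (P0 `|` X) /\ forall n, ~ (P0 `|` X) (y ^+ n)].
have [F Fav Ftot|X [[idX Xy] Xmax]] := @Zorn_bigcup T avoids.
  have sub Y : F Y -> P0 `|` Y `<=` P0 `|` \bigcup_(X in F) X.
    by move=> FY x [P0x|Yx]; [left|right; exists Y].
  split; last first.
    by move=> n [/P0y //|[Y FY Yn]]; have [_ /(_ n)] := Fav Y FY; apply; right.
  apply/ideal_subbimodule; split; first by left; exact: ideal0.
    have mono Y x z : F Y -> (P0 `|` Y) x -> (P0 `|` Y) z ->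
        (P0 `|` \bigcup_(X in F) X) (x - z).
      by move=> FY Yx Yz; apply: (sub Y FY); apply: idealB Yx Yz; have [] := Fav Y FY.
    move=> x z [P0x|[Y FY Yx]] [P0z|[Z FZ Zz]].
    - by left; exact: idealB.
    - by apply: (mono Z) => //; [left|right].
    - by apply: (mono Y) => //; [right|left].
    - have [YZ|ZY] := Ftot Y Z FY FZ.
        by apply: (mono Z) => //; right => //; exact: YZ.
      by apply: (mono Y) => //; right => //; exact: ZY.
  move=> r x _ [P0x|[Y FY Yx]].
    by split; left; [exact: idealMl|exact: idealMr].
  have [idY _] := Fav Y FY.
  by split; apply: (sub Y FY); [apply: idealMl|apply: idealMr] => //; right.
pose P := P0 `|` X.
have avoidP (J : set T) : is_ideal J -> ~ (J `<=` P) ->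
    exists n x, J x /\ P (x - y ^+ n).
  move=> idJ JP; apply: contrapT => noJ.
  (* The sum already contains [P0], so [set_add J P] is itself a competitor for the maximal [X]. *)
  have P0J : P0 `|` set_add J P = set_add J P.
    apply/setUidPr => x P0x; apply: set_addr; first exact: ideal0.
    by left.
  have idJP : is_ideal (set_add J P) by exact: set_add_ideal.
  apply: (Xmax (set_add J P)); last first.
    split; rewrite P0J // => n [x Jx [p Pp xp]].
    apply: noJ; exists n, x; split=> //; rewrite -xp opprD addrA subrr sub0r.
    by apply: subbimoduleN Pp; exact: (proj1 (ideal_subbimodule _) idX).
  split=> [x Xx|JPX]; first by apply: set_addr; [exact: ideal0|right].
  by apply: JP => x Jx; right; apply: JPX; apply: set_addl Jx; exact: ideal0.
exists P; split.
- apply/strongly_primeP; split; last first.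
    move=> J idJ nilJ; apply: contrapT => /(avoidP J idJ)[n [x [Jx Px]]].
    have [m Pxm] := nilJ x Jx; apply: (Xy (n * m)%N).
    rewrite exprM -[_ ^+ m](subKr (x ^+ m)); apply: idealB => //.
    exact: ideal_expB.
  split=> //.
    by move=> PT; apply: (Xy 0%N); rewrite -/P PT.
  move=> A B idA idB ABP; apply: contrapT => /not_orP[].
  move=> /(avoidP A idA)[n [a [Aa Pa]]] /(avoidP B idB)[m [b [Bb Pb]]].
  apply: (Xy (n + m)%N); rewrite -/P exprD.
  have -> : y ^+ n * y ^+ m =
      a * b - ((a - y ^+ n) * b + y ^+ n * (b - y ^+ m)).
    by rewrite mulrBl mulrBr addrA subrK opprB addrC subrK.
  apply: idealB => //; first exact/ABP/set_mul_mem.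
  by apply: idealD => //; [exact: idealMr|exact: idealMl].
- by move=> x; left.
- by have := Xy 1%N; rewrite expr1.
Qed.

(** The ideal generated by [x] is not nil, so it holds a non-nilpotent [y]; a strongly prime ideal
    avoiding [y] cannot contain [x]. The converse inclusion is [nil_sub_strongly_prime]. *)
Lemma upper_nilradical_avoiding (T : pzRingType) (x : T) :
  ~ nil_union x -> exists2 P, is_strongly_prime P & ~ P x.
Proof.
move=> xN; pose J := [set z | forall K : set T, is_ideal K -> K x -> K z].
have idJ : is_ideal J.
  apply/ideal_subbimodule; split.
  - by move=> K idK _; exact: ideal0.
  - by move=> a b Ja Jb K idK Kx; apply: idealB => //; [exact: Ja|exact: Jb].
  - by move=> r a _ Ja; split=> K idK Kx; [apply: idealMl|apply: idealMr] => //;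
      exact: Ja.
have [y [Jy yn0]] : exists y, J y /\ forall n, y ^+ n <> 0.
  apply: contrapT => nilJ; apply: xN; exists J; last by move=> K.
  split=> // y Jy; apply: contrapT => yn0; apply: nilJ.
  by exists y; split=> // n yn; apply: yn0; exists n.
have [P [sP _ Py]] := strongly_prime_avoiding (zero_ideal T) yn0.
have [[idP _ _] _] := proj1 (strongly_primeP _) sP.
by exists P => // Px; apply: Py; exact: Jy.
Qed.

Lemma nil_sub_strongly_prime (T : pzRingType) (P J : set T) :
  is_strongly_prime P -> is_ideal J -> is_nil J -> J `<=` P.
Proof.
move=> /strongly_primeP[[idP _ _] nilP] idJ nilJ; apply: nilP => // x Jx.
by have [n xn] := nilJ x Jx; exists n; rewrite xn; exact: ideal0.
Qed.

(** * The nilradical of a subring, and the first isomorphism theorem *)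

(** With [subring_nilradical_largest], this characterises the nilradical of [R] inside [T], as the
    largest nil [R]-subbimodule contained in [R], so that the subtype can be left behind. *)
Lemma subring_nilradical_spec (T : pzRingType) (R : subring T) :
  [/\ subring_nilradical R `<=` R,
      is_subbimodule R (subring_nilradical R) & is_nil (subring_nilradical R)].
Proof.
have idN : is_ideal (upper_nilradical (subring_type R)) := idealP _.
split.
- by move=> _ [x _ <-]; exact: set_mem (valP x).
- split.
  + by exists 0; [exact: ideal0|rewrite rmorph0].
  + move=> _ _ [x Nx <-] [y Ny <-].
    by exists (x - y); [exact: idealB|rewrite rmorphB].
  + move=> r _ Rr [x Nx <-].
    pose s : subring_type R := Sub r (mem_set Rr : r \in subring_pred R).
    have sr : \val s = r by exact: SubK.
    by rewrite -sr -!rmorphM; split; [exists (s * x)|exists (x * s)] => //;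
      [exact: idealMl|exact: idealMr].
- move=> _ [x [I [_ nilI] Ix] <-]; have [n xn] := nilI x Ix; exists n.
  by rewrite -rmorphXn xn rmorph0.
Qed.

Lemma subring_nilradical_largest (T : pzRingType) (R : subring T) (A : set T) :
  A `<=` R -> is_subbimodule R A -> is_nil A -> A `<=` subring_nilradical R.
Proof.
move=> AR [A0 AB AM] nilA a Aa.
pose s : subring_type R := Sub a (mem_set (AR a Aa) : a \in subring_pred R).
pose f : {rmorphism subring_type R -> T} := \val.
exists s => //; exists [set x | A (f x)]; last exact: Aa.
split.
  apply/ideal_subbimodule; split; rewrite /mkset.
  - by rewrite rmorph0.
  - by move=> x y Ax Ay; rewrite rmorphB; exact: AB.
  - by move=> r x _ Ax; rewrite !rmorphM; apply: AM => //; exact: set_mem (valP r).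
move=> x /nilA[n xn]; exists n; apply: val_inj.
by rewrite -[LHS]/(f _) -[RHS]/(f 0) rmorphXn rmorph0.
Qed.

Lemma first_isomorphism (S T : pzRingType) (f : {rmorphism S -> T})
    (J : ideal S) :
  (forall y, exists x, f x = y) -> (forall x, f x = 0 <-> ideal_set J x) ->
  ring_isomorphic (quotient J) T.
Proof.
move=> fS fJ.
(* Evaluation at the chosen representative; [gE] is independence of that choice. *)
pose g (q : quotient J) : T := f (repr (q : Quotient.quot (ideal_pred J))).
have gE x : g (quotient_proj J x) = f x.
  apply/eqP; rewrite -subr_eq0 -rmorphB; apply/eqP/fJ.
  apply/quotient_proj_eq0; rewrite rmorphB; apply/eqP; rewrite subr_eq0.
  by apply/eqP; exact: reprK.
have gB : zmod_morphism g.
  move=> p q; have [x <-] := quotient_proj_surj p.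
  by have [y <-] := quotient_proj_surj q; rewrite -rmorphB !gE rmorphB.
have gM : monoid_morphism g.
  split; first by rewrite -(rmorph1 (quotient_proj J)) gE rmorph1.
  move=> p q; have [x <-] := quotient_proj_surj p.
  by have [y <-] := quotient_proj_surj q; rewrite -rmorphM !gE rmorphM.
pose gadd := GRing.isZmodMorphism.Build _ _ g gB.
pose gmul := GRing.isMonoidMorphism.Build _ _ g gM.
pose h : {rmorphism quotient J -> T} := HB.pack g gadd gmul.
(* A section [k] of [f], followed by the projection, inverts [h]. *)
have [k fk] := choice fS.
exists h, (quotient_proj J \o k) => [q|y]; last by rewrite /= gE fk.
have [x <-] := quotient_proj_surj q.
apply/eqP; rewrite -subr_eq0 /= gE -rmorphB; apply/eqP/quotient_proj_eq0/fJ.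
by rewrite rmorphB fk subrr.
Qed.

(** * Sums with a maximal subring *)

Lemma subring_subbimodule (T : pzRingType) (R : subring T) :
  is_subbimodule R R.
Proof.
split; first exact: set_mem (rpred0 (subring_pred R)).
  move=> x y Rx Ry; apply: set_mem.
  by apply: (@rpredB _ (subring_pred R)); exact: mem_set.
move=> x y Rx Ry; split; apply: set_mem;
  by apply: (@rpredM _ (subring_pred R)); exact: mem_set.
Qed.

(** Since [(r + a) * (s + b) = r * s + (r * b + (a * s + a * b))], the sum [R + A] is a subring
    containing [R], and maximality leaves only [R] and [T]. *)
Lemma maximal_subring_add (T : pzRingType) (R : subring T) (A : set T) :
  maximal_subring R -> is_subbimodule R A ->
  (forall a b, A a -> A b -> A (a * b)) ->
  A `<=` R \/ set_add R A = setT.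
Proof.
move=> [_ maxR] mA AA; have [A0 AB AM] := mA.
have [R0 RB RM] := subring_subbimodule R.
have R1 : (R : set T) 1 by exact: set_mem (rpred1 (subring_pred R)).
have closedS : subring_closed [in set_add R A].
  split.
  - by apply: mem_set; exact: set_addl.
  - move=> _ _ /set_mem[r Rr [a Aa <-]] /set_mem[s Rs [b Ab <-]].
    apply: mem_set; exists (r - s); first exact: RB.
    by exists (a - b); [exact: AB|rewrite opprD addrACA].
  - move=> _ _ /set_mem[r Rr [a Aa <-]] /set_mem[s Rs [b Ab <-]].
    apply: mem_set; exists (r * s); first by have [] := RM r s Rr Rs.
    exists (r * b + (a * s + a * b)); last by rewrite mulrDl !mulrDr !addrA.
    apply: (subbimoduleD mA); first by have [] := AM r b Rr Ab.
    by apply: (subbimoduleD mA); [have [] := AM s a Rs Aa|exact: AA].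
have [SR|ST] := maxR (Subring closedS) (set_addl A0); last by right.
by left=> a Aa; rewrite -SR; exact: set_addr.
Qed.

(** As [R + J] is everything, the nilradical of [R] plus [J] is an ideal of [T]: [J] absorbs the
    [J]-component of each multiplier. It is nil modulo [J], hence modulo [P]. The lemma serves once
    with [J = P] and once with [P = set_add Q J]. *)
Lemma nilradical_sub_strongly_prime (T : pzRingType) (R : subring T)
    (J P : set T) :
  is_strongly_prime P -> is_ideal J -> J `<=` P -> set_add R J = setT ->
  subring_nilradical R `<=` P.
Proof.
move=> /strongly_primeP[_ nilP] idJ JP RJT.
have [NR mN nilN] := subring_nilradical_spec R; have [N0 NB NM] := mN.
apply: subset_trans (set_addl (ideal0 idJ)) _; apply: nilP.
  apply/ideal_subbimodule; split.
  - by apply: set_addl => //; exact: ideal0.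
  - move=> _ _ [a Aa [b Bb <-]] [a' Aa' [b' Bb' <-]].
    exists (a - a'); first exact: NB.
    by exists (b - b'); [exact: idealB|rewrite opprD addrACA].
  - move=> t _ _ [a Na [j Jj <-]].
    have [r Rr [k Jk <-]] : set_add R J t by rewrite RJT.
    have [Nra Nar] := NM r a Rr Na; split.
      exists (r * a) => //; exists (k * a + (r + k) * j).
        by apply: idealD => //; [exact: idealMr|exact: idealMl].
      by rewrite mulrDr addrA -mulrDl.
    exists (a * r) => //; exists (a * k + j * (r + k)).
      by apply: idealD => //; [exact: idealMl|exact: idealMr].
    by rewrite mulrDl addrA -mulrDr.
move=> _ [a Na [j Jj <-]]; have [n an] := nilN a Na; exists n; apply: JP.
rewrite -[_ ^+ n]subr0 -an; apply: ideal_expB => //.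
by rewrite addrC addKr.
Qed.

(** The nilradical of [T] meets [R] in a nil ideal of [R], which gives one inclusion; the hypothesis
    gives the other. *)
Lemma sub_subring_eq_upper_nilradical (T : pzRingType) (R : subring T) :
  subring_nilradical R `<=` upper_nilradical T ->
  upper_nilradical T `&` R = subring_nilradical R.
Proof.
have idN : is_ideal (upper_nilradical T) := idealP _.
move=> NT; have [NR mN nilN] := subring_nilradical_spec R.
apply/seteqP; split=> [|x Nx]; last by split; [exact: NT|exact: NR].
apply: subring_nilradical_largest; first by move=> x [].
  apply: subbimoduleI; first exact: ideal_subr.
  exact: subring_subbimodule.
by move=> x [/nil_union_nil].
Qed.

(** * Cancellation modulo a prime ideal *)

(** The [z] with [I z] inside [P] form an ideal [K], and [I K] lies in [P]; primeness puts [K] in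
    [P]. *)
Lemma prime_ideal_cancell (T : pzRingType) (P I : set T) (x : T) :
  is_prime_ideal P -> is_ideal I -> ~ I `<=` P ->
  (forall i, I i -> P (i * x)) -> P x.
Proof.
move=> primeP idI IP IxP; have [idP _ _] := primeP.
have idK : is_ideal [set z | forall i, I i -> P (i * z)].
  apply/ideal_subbimodule; split.
  - by move=> i _; rewrite mulr0; exact: ideal0.
  - by move=> a b Pa Pb i Ii; rewrite mulrBr; apply: idealB; auto.
  - move=> r a _ Pa; split=> i Ii; rewrite mulrA.
      by apply: Pa; exact: idealMr.
    by apply: idealMr => //; exact: Pa.
have [a b Ia Kb|//|KP] := prime_ideal_mul primeP idI idK; first exact: Kb.
exact: KP.
Qed.

Lemma prime_ideal_cancelr (T : pzRingType) (P I : set T) (x : T) :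
  is_prime_ideal P -> is_ideal I -> ~ I `<=` P ->
  (forall i, I i -> P (x * i)) -> P x.
Proof.
move=> primeP idI IP xIP; have [idP _ _] := primeP.
have idK : is_ideal [set z | forall i, I i -> P (z * i)].
  apply/ideal_subbimodule; split.
  - by move=> i _; rewrite mul0r; exact: ideal0.
  - by move=> a b Pa Pb i Ii; rewrite mulrBl; apply: idealB; auto.
  - move=> r a _ Pa; split=> i Ii; rewrite -mulrA.
      by apply: idealMl => //; exact: Pa.
    by apply: Pa; exact: idealMl.
have [a b Ka Ib|KP|//] := prime_ideal_mul primeP idK idI; first exact: Ka.
exact: KP.
Qed.

Lemma subset_set0 (T : pzRingType) (I : set T) :
  I 0 -> I <> [set 0] -> ~ I `<=` [set 0].
Proof. by move=> I0 In0 I0s; apply: In0; apply/seteqP; split=> // _ ->. Qed.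

(** * Ideals meeting a maximal subring trivially *)

Section Complement.
Variables (T : pzRingType) (R : subring T).
Hypothesis maxR : maximal_subring R.
Implicit Types I Q : set T.

Lemma complement_sum I :
  is_ideal I -> I <> [set 0] -> R `&` I = [set 0] -> set_add R I = setT.
Proof.
move=> idI In0 RI0.
have [a b _|IR|//] := maximal_subring_add maxR (ideal_subr R idI).
  exact: idealMl.
case: (subset_set0 (ideal0 idI) In0) => x Ix.
by rewrite -RI0; split=> //; exact: IR.
Qed.

Lemma complement_minimal I (C : set T) :
  is_ideal I -> R `&` I = [set 0] -> is_subbimodule R C ->
  (forall a b, C a -> C b -> C (a * b)) -> C `<=` I -> C <> [set 0] -> C = I.
Proof.
move=> idI RI0 mC CC CI Cn0.
have [CR|RCT] := maximal_subring_add maxR mC CC.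
  case: (@subset_set0 _ C) => //; first by case: mC.
  by move=> x Cx; rewrite -RI0; split; [exact: CR|exact: CI].
apply/seteqP; split=> // i Ii.
have [r Rr [c Cc rci]] : set_add R C i by rewrite RCT.
(* [r = i - c] lies in [I] because [C] is inside [I], so it lies in the zero intersection and
   [i = c]. *)
have : (R `&` I) r.
  split=> //; rewrite -[r](addrK c) rci; apply: idealB => //.
  exact: CI.
by rewrite RI0 => r0; rewrite -rci r0 add0r.
Qed.

Lemma complement_not_sub I Q :
  is_ideal I -> I <> [set 0] -> R `&` I = [set 0] -> Q `<=` R -> ~ I `<=` Q.
Proof.
move=> idI In0 RI0 QR IQ; case: (subset_set0 (ideal0 idI) In0) => x Ix.
by rewrite -RI0; split=> //; exact/QR/IQ.
Qed.

(** Both products are subbimodules inside [I] closed under multiplication, so by minimality only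
    their vanishing must be excluded: [I A = 0] or [A I = 0] lies in [Q], and cancelling [I] would
    put [A] in [Q]. *)
Lemma complement_mul I Q (A : set T) :
  is_ideal I -> I <> [set 0] -> R `&` I = [set 0] ->
  is_prime_ideal Q -> Q `<=` R -> is_subbimodule R A -> ~ A `<=` Q ->
  set_mul I A = I /\ set_mul A I = I.
Proof.
move=> idI In0 RI0 primeQ QR mA AQ; have [idQ _ _] := primeQ.
have IQ := complement_not_sub idI In0 RI0 QR.
have mI := proj1 (ideal_subbimodule _) idI.
have IAI : set_mul I A `<=` I.
  by apply: (set_mul_sub mI) => a b Ia _; exact: idealMr.
have AII : set_mul A I `<=` I.
  by apply: (set_mul_sub mI) => a b _ Ib; exact: idealMl.
have mIR := ideal_subr R idI.
split; apply: complement_minimal => //.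
- exact: set_mul_subbimodule.
- by move=> x y _ IAy; apply: set_mulMl => // a; exact: idealMl.
- move=> IA0; apply: AQ => a Aa.
  apply: (prime_ideal_cancell primeQ idI IQ) => i Ii.
  have : set_mul I A (i * a) by exact: set_mul_mem.
  by rewrite IA0 => ->; exact: ideal0.
- exact: set_mul_subbimodule.
- by move=> x y AIx _; apply: set_mulMr => // b; exact: idealMr.
- move=> AI0; apply: AQ => a Aa.
  apply: (prime_ideal_cancelr primeQ idI IQ) => i Ii.
  have : set_mul A I (a * i) by exact: set_mul_mem.
  by rewrite AI0 => ->; exact: ideal0.
Qed.

(** If [x] lies in one of these sets, its product with [I] on a suitable side lies in [R] and in
    [I], or vanishes outright, hence is in [Q]; cancelling [I] gives [x] in [Q]. Conversely [Q] is
    an ideal inside [R], and [Q I] and [I Q] lie in the zero intersection of [R] and [I]. *)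
Lemma complement_ann I Q :
  is_ideal I -> I <> [set 0] -> R `&` I = [set 0] ->
  is_prime_ideal Q -> Q `<=` R ->
  [/\ conductor R = Q, conductorl R = Q, conductorr R = Q & ann I = Q].
Proof.
move=> idI In0 RI0 primeQ QR; have [idQ _ _] := primeQ.
have IQ := complement_not_sub idI In0 RI0 QR.
have RIQ x : (R : set T) x -> I x -> Q x.
  move=> Rx Ix; have : (R `&` I) x by [].
  by rewrite RI0 => ->; exact: ideal0.
have QI0 x : Q x -> I x -> x = 0.
  move=> Qx Ix; have : (R `&` I) x by split=> //; exact: QR.
  by rewrite RI0.
split; apply/seteqP; split=> x xH.
- apply: (prime_ideal_cancell primeQ idI IQ) => i Ii.
  by apply: RIQ; [have := xH i 1; rewrite mulr1|exact: idealMr].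
- by move=> s t; apply: QR; apply: idealMr => //; exact: idealMl.
- apply: (prime_ideal_cancell primeQ idI IQ) => i Ii.
  by apply: RIQ; [exact: xH|exact: idealMr].
- by move=> s; apply: QR; exact: idealMl.
- apply: (prime_ideal_cancelr primeQ idI IQ) => i Ii.
  by apply: RIQ; [exact: xH|exact: idealMl].
- by move=> s; apply: QR; exact: idealMr.
- apply: (prime_ideal_cancell primeQ idI IQ) => i Ii.
  by have [_ ->] := xH i Ii; exact: ideal0.
- by move=> i Ii; split; apply: QI0;
    [exact: idealMr|exact: idealMl|exact: idealMl|exact: idealMr].
Qed.

(** The intersection of [I] and [I1] is nonzero, since it contains [I I1] while the prime [Q]
    contains neither ideal; minimality then equates it with both. *)
Lemma complement_uniq I I1 Q :
  is_ideal I -> I <> [set 0] -> R `&` I = [set 0] ->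
  is_ideal I1 -> I1 <> [set 0] -> R `&` I1 = [set 0] ->
  is_prime_ideal Q -> Q `<=` R -> I1 = I.
Proof.
move=> idI In0 RI0 idI1 I1n0 RI10 primeQ QR; have [idQ _ _] := primeQ.
have mC : is_subbimodule R (I `&` I1).
  by apply: subbimoduleI; exact: ideal_subr.
have CC a b : (I `&` I1) a -> (I `&` I1) b -> (I `&` I1) (a * b).
  by move=> [Ia I1a] _; split; exact: idealMr.
have Cn0 : I `&` I1 <> [set 0].
  move=> C0; have [||] := prime_ideal_mul primeQ idI idI1.
  - move=> a b Ia I1b; have : (I `&` I1) (a * b).
      by split; [exact: idealMr|exact: idealMl].
    by rewrite C0 => ->; exact: ideal0.
  - exact: complement_not_sub.
  - exact: complement_not_sub.
rewrite -(complement_minimal idI RI0 mC CC _ Cn0); last by move=> x [].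
by rewrite (complement_minimal idI1 RI10 mC CC _ Cn0) // => x [].
Qed.

(** The modular law: since [Q] is inside [R], the part of [Q + I] in [R] is [Q] plus the zero
    intersection. *)
Lemma complement_add_mem I Q (x : T) :
  R `&` I = [set 0] -> Q `<=` R -> (R : set T) x -> set_add Q I x -> Q x.
Proof.
move=> RI0 QR Rx [q Qq [i Ii qix]].
have [_ RB _] := subring_subbimodule R.
have : (R `&` I) i.
  by split=> //; rewrite -[i](addKr q) addrC qix; apply: RB => //; exact: QR.
by rewrite RI0 => i0; rewrite -qix i0 addr0.
Qed.

(* T/(Q + I) is R/Q, in which 0 is prime: if AB lies in Q but A does not, then
   IA = I, so IB lies in Q, and hence B does. *)
Lemma complement_add_prime I Q :
  is_ideal I -> I <> [set 0] -> R `&` I = [set 0] ->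
  is_prime_ideal Q -> Q `<=` R -> is_prime_ideal (set_add Q I).
Proof.
move=> idI In0 RI0 primeQ QR; have [idQ QT _] := primeQ.
have IQ := complement_not_sub idI In0 RI0 QR.
have idP := set_add_ideal idQ idI.
have mR := subring_subbimodule R; have [R0 RB RM] := mR.
split=> //.
  move=> PT; apply: QT; apply: ideal_top => //.
  apply: (complement_add_mem RI0 QR); last by rewrite PT.
  exact: set_mem (rpred1 (subring_pred R)).
move=> A B idA idB ABP; apply: contrapT => /not_orP[nA nB].
(* [lift C] is the ideal of [R] with the same image as [C] modulo [I]; it is an [R]-subbimodule to
   which [complement_mul] applies. *)
pose lift (C : set T) := R `&` set_add C I.
have mlift C : is_ideal C -> is_subbimodule R (lift C).
  by move=> idC; apply: subbimoduleI => //; exact/ideal_subr/set_add_ideal.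
have liftQ C : is_ideal C -> ~ C `<=` set_add Q I -> ~ lift C `<=` Q.
  move=> idC nC CQ; apply: nC => c Cc.
  have [r Rr [i Ii ric]] : set_add R I c by rewrite complement_sum.
  exists r; last by exists i.
  apply: CQ; split=> //; exists c => //; exists (- i).
    exact: subbimoduleN (ideal_subr setT idI) Ii.
  by rewrite -ric addrK.
have [IA _] := complement_mul idI In0 RI0 primeQ QR (mlift A idA) (liftQ A idA nA).
apply: (liftQ B idB nB) => b liftb.
apply: (prime_ideal_cancell primeQ idI IQ) => i.
(* With [i] written as a sum of products from [I] and [lift A], it suffices that each [a * b] is in
   [Q], that is, in both [R] and [Q + I]. *)
rewrite -{1}IA; move: i.
have mC : is_subbimodule set0 [set i | Q (i * b)].
  split=> //; first by rewrite /mkset mul0r; exact: ideal0.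
  by move=> x y Qx Qy; rewrite /mkset mulrBl; exact: idealB.
apply: (set_mul_sub mC) => i a Ii lifta; rewrite /mkset -mulrA.
apply: idealMl => //; apply: (complement_add_mem RI0 QR).
  by have [] := RM a b lifta.1 liftb.1.
have [_ [a' Aa' [j Ij <-]]] := lifta; have [_ [b' Bb' [k Ik <-]]] := liftb.
rewrite mulrDl [a' * _]mulrDr -addrA; apply: idealD => //.
  exact/ABP/set_mul_mem.
apply: set_addr; first exact: ideal0.
by apply: idealD => //; [exact: idealMl|exact: idealMr].
Qed.

End Complement.

(** * Maximal ideals and chains of primes *)

(** If [J + M] were everything, some [j] in [J] would be 1 modulo [M], and so would all its powers;
    one of them is in [M], so [M] would contain 1. *)
Lemma maximal_strongly_prime (T : pzRingType) (M : set T) :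
  is_maximal_ideal M -> is_prime_ideal M -> is_strongly_prime M.
Proof.
move=> [idM MT maxM] primeM; apply/strongly_primeP; split=> // J idJ nilJ.
have [||JM|JT] := maxM (set_add J M).
- exact: set_add_ideal.
- by apply: set_addr; exact: ideal0.
- by rewrite -[X in _ `<=` X]JM; apply: set_addl; exact: ideal0.
case: MT; apply: ideal_top => //.
have [j Jj [m Mm jm1]] : set_add J M 1 by rewrite JT.
have [n Mjn] := nilJ j Jj.
have := idealB idM Mjn (ideal_expB n idM (_ : M (j - 1))).
rewrite subKr expr1n; apply; rewrite -jm1 opprD addrA subrr sub0r.
exact: subbimoduleN (ideal_subr setT idM) Mm.
Qed.

Lemma krull_dim_ge2 (T : pzRingType) (P0 P1 P2 : set T) :
  is_prime_ideal P0 -> is_prime_ideal P1 -> is_prime_ideal P2 ->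
  P0 `<` P1 -> P1 `<` P2 -> (2%:Z%:E <= krull_dim T)%E.
Proof.
move=> pP0 pP1 pP2 P01 P12; apply: (krull_dim_is_sup T).1; exists 2%N => //.
(* The default [setT] is never reached, as the indices are at most 2. *)
exists (fun i => nth setT [:: P0; P1; P2] i); split.
  by case=> [[|[|[|//]]] ?].
case=> [[|[|[|//]]] ?] [[|[|[|//]]] ?] //= _.
(* Only the pair of indices 0 and 2 remains, by transitivity. *)
have [[s01 _] [s12 n21]] := (P01, P12); split; first exact: subset_trans s12.
by move=> s20; apply: n21; exact: subset_trans s20 s01.
Qed.

(* When R does not contain Q, R + Q = T, so the image of the nilradical of R is
   a nil ideal of T/Q. *)
Lemma strongly_prime_sub (T : pzRingType) (R : subring T) :
  maximal_subring R -> ~ subring_nilradical R `<=` upper_nilradical T ->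
  exists Q : set T,
    [/\ is_strongly_prime Q, Q `<=` R & ~ subring_nilradical R `<=` Q].
Proof.
move=> maxR /existsNP[x /not_implyP[Nx /upper_nilradical_avoiding[Q sQ Qx]]].
have NQ : ~ subring_nilradical R `<=` Q by move=> /(_ x Nx).
exists Q; split=> //; have [[idQ _ _] _] := proj1 (strongly_primeP _) sQ.
have [a b _|//|RQT] := maximal_subring_add maxR (ideal_subr R idQ).
  exact: idealMl.
by case: NQ; exact: (nilradical_sub_strongly_prime sQ idQ _ RQT).
Qed.

(** * Quotients by the nilradicals, and assembly of the alternatives *)

(** The map from [R] to the quotient of [T] is onto because the sum is [T], and its kernel is the
    intersection in the first hypothesis. *)
Lemma quotient_nilradical_iso (T : pzRingType) (R : subring T) :
  upper_nilradical T `&` R = subring_nilradical R ->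
  set_add R (upper_nilradical T) = setT ->
  ring_isomorphic (quotient (upper_nilradical (subring_type R)))
                  (quotient (upper_nilradical T)).
Proof.
move=> NRN RNT.
pose v : {rmorphism subring_type R -> T} := \val.
pose p : {rmorphism T -> quotient (upper_nilradical T)} := @quotient_proj T _.
apply: (@first_isomorphism _ _ (p \o v)).
  move=> y; have [t <-] := quotient_proj_surj y.
  have [r Rr [n Nn <-]] : set_add R (upper_nilradical T) t by rewrite RNT.
  exists (Sub r (mem_set Rr : r \in subring_pred R)).
  have pn : p n = 0 by apply/quotient_proj_eq0.
  by rewrite -[quotient_proj _ _]/(p (r + n)) rmorphD pn addr0.
move=> x; split=> [/(quotient_proj_eq0 (upper_nilradical T)) Nx|Nx].
  have : (upper_nilradical T `&` R) (\val x).
    by split=> //; exact: set_mem (valP x).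
  by rewrite NRN => -[z Nz /val_inj <-].
apply/(quotient_proj_eq0 (upper_nilradical T)).
have : subring_nilradical R (\val x) by exists x.
by rewrite -NRN => -[].
Qed.

Theorem theorem3p10 (T : pzRingType) (R : subring T)
    (maxR : maximal_subring R) :
  ((exists Q : set T,
      [/\ is_strongly_prime Q, Q `<=` R,
          upper_nilradical T `<=` Q & Q `<=` conductor R])
   \/
   (upper_nilradical T `&` R = subring_nilradical R /\
    (upper_nilradical T = subring_nilradical R :> set T \/
     ring_isomorphic (quotient (upper_nilradical (subring_type R)))
                     (quotient (upper_nilradical T)))))
  /\
  (forall I : set T, is_ideal I -> I <> [set 0] -> R `&` I = [set 0] ->
     upper_nilradical T `&` R = subring_nilradical R
     \/
     [/\ set_mul I I = I,
         [/\ conductor R = conductorl R, conductorl R = conductorr R,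
             conductorr R = ann I, is_strongly_prime (conductor R) &
             is_minimal_prime (conductor R)],
         [/\ ~ (subring_nilradical R `<=` conductor R),
             set_mul I (subring_nilradical R) =
               set_mul (subring_nilradical R) I &
             set_mul setT (subring_nilradical R) =
               set_mul (subring_nilradical R) setT],
         [/\ conductor R `&` I = [set 0],
             is_prime_ideal (set_add (conductor R) I),
             ~ is_strongly_prime (set_add (conductor R) I),
             ~ is_maximal_ideal (set_add (conductor R) I) &
             (2%:Z%:E <= krull_dim T)%E] &
         forall I1 : set T, is_ideal I1 -> I1 <> [set 0] ->
           R `&` I1 = [set 0] -> I1 = I]).
Proof.
have idN := nil_union_is_ideal T.
have mN := ideal_subr R idN.
split.
  have [NT|NT] := pselect (subring_nilradical R `<=` upper_nilradical T).
    right; have NRN := sub_subring_eq_upper_nilradical NT; split=> //.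
    (* Maximality for the nilradical of [T]: inside [R] it equals that of [R]; otherwise the sum is
       [T] and the quotients are isomorphic. *)
    have [a b _|NR|RNT] := maximal_subring_add maxR mN.
    - exact: idealMl.
    - by left; rewrite -NRN; apply/esym/setIidPl.
    - by right; exact: quotient_nilradical_iso.
  left; have [Q [sQ QR _]] := strongly_prime_sub maxR NT.
  have [[idQ _ _] _] := proj1 (strongly_primeP _) sQ.
  exists Q; split=> //.
    exact: nil_sub_strongly_prime sQ idN (@nil_union_nil T).
  by move=> q Qq s t; apply: QR; apply: idealMr => //; exact: idealMl.
move=> I idI In0 RI0.
have [NT|NT] := pselect (subring_nilradical R `<=` upper_nilradical T).
  by left; exact: sub_subring_eq_upper_nilradical.
right; have [Q [sQ QR NQ]] := strongly_prime_sub maxR NT.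
have [primeQ _] := proj1 (strongly_primeP _) sQ.
have [idQ QT _] := primeQ.
have IQ := complement_not_sub idI In0 RI0 QR.
have [condE condlE condrE annE] := complement_ann idI In0 RI0 primeQ QR.
have [NR modN nilN] := subring_nilradical_spec R; have [_ _ NM] := modN.
have [IN NI] := complement_mul maxR idI In0 RI0 primeQ QR modN NQ.
have RIT := complement_sum maxR idI In0 RI0.
have primeP := complement_add_prime maxR idI In0 RI0 primeQ QR.
have [idP PT _] := primeP.
have IP : I `<=` set_add Q I by apply: set_addr; exact: ideal0.
(* As [R + I] is [T], strong primeness would put the nilradical of [R] in [Q + I], whose part in [R]
   is [Q], against [NQ]. *)
have nsP : ~ is_strongly_prime (set_add Q I).
  move=> sP; apply: NQ => n Nn.
  apply: (complement_add_mem RI0 QR); first exact: NR.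
  exact: (nilradical_sub_strongly_prime sP idI IP RIT).
rewrite condE condlE condrE annE; split.
- by have [] := complement_mul maxR idI In0 RI0 primeQ QR (ideal_subr R idI) IQ.
- split=> //; split=> // P' primeP' P'Q; apply/seteqP; split=> // q Qq.
  have [idP' _ _] := primeP'.
  (* Minimality: [I Q = 0] lies in [P'], and [I] can be cancelled because it is not inside [Q],
     hence not inside [P']. *)
  apply: (prime_ideal_cancell primeP' idI) => [IP'|i Ii].
    exact/IQ/(subset_trans IP').
  move: Qq; rewrite -annE => /(_ i Ii)[_ ->]; exact: ideal0.
- split=> //; first by rewrite IN NI.
  have mTN : is_subbimodule set0 (set_mul setT (subring_nilradical R)).
    by apply: set_mul_subbimodule; [split|exact: (subbimoduleS (@sub0set _ _) modN)].
  have mNT : is_subbimodule set0 (set_mul (subring_nilradical R) setT).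
    by apply: set_mul_subbimodule; [exact: (subbimoduleS (@sub0set _ _) modN)|split].
  (* For [t = r + i], the [R]-part sends the nilradical [N] into itself, and the [I]-part sends it
     into [I], which equals both [I N] and [N I] and so lies in both [T N] and [N T]. *)
  have ITN : I `<=` set_mul setT (subring_nilradical R).
    by rewrite -{1}IN; apply: (set_mul_sub mTN) => a b _ Nb; exact: set_mul_mem.
  have INT : I `<=` set_mul (subring_nilradical R) setT.
    by rewrite -{1}NI; apply: (set_mul_sub mNT) => a b Na _; exact: set_mul_mem.
  apply/seteqP; split.
    apply: (set_mul_sub mNT) => t n _ Nn.
    have [r Rr [i Ii <-]] : set_add R I t by rewrite RIT.
    rewrite mulrDl; apply: (subbimoduleD mNT); last by apply: INT; exact: idealMr.
    rewrite -[r * n]mulr1; apply: set_mul_mem => //.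
    by have [] := NM r n Rr Nn.
  apply: (set_mul_sub mTN) => n t Nn _.
  have [r Rr [i Ii <-]] : set_add R I t by rewrite RIT.
  rewrite mulrDr; apply: (subbimoduleD mTN); last by apply: ITN; exact: idealMl.
  rewrite -[n * r]mul1r; apply: set_mul_mem => //.
  by have [] := NM r n Rr Nn.
- split=> //.
  + apply/seteqP; split=> [y [Qy Iy]|_ ->]; last by split; exact: ideal0.
    by rewrite -RI0; split=> //; exact: QR.
  + by move=> maxP; apply: nsP; exact: maximal_strongly_prime.
  (* The chain is [Q], [Q + I], [M], where [M] is a strongly prime ideal over [Q + I] found by
     avoiding the powers of 1; the last step is strict because [Q + I] is not strongly prime. *)
  + have P1 n : ~ set_add Q I (1 ^+ n).
      by rewrite expr1n => P1; apply: PT; exact: ideal_top.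
    have [M [sM PM _]] := strongly_prime_avoiding idP P1.
    have [primeM _] := proj1 (strongly_primeP _) sM.
    apply: (krull_dim_ge2 primeQ primeP primeM); split=> //.
    * by apply: set_addl; exact: ideal0.
    * by move=> PQ; apply: IQ; exact: subset_trans PQ.
    * move=> MP; apply: nsP.
      by rewrite (_ : set_add Q I = M) //; apply/seteqP.
- move=> I1 idI1 I1n0 RI10.
  exact: (complement_uniq maxR idI In0 RI0 idI1 I1n0 RI10 primeQ QR).
Qed.
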